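(* Let $x\in\mathrm{Dom}(\Phi)$. Suppose $u$ is feasible path transfer upper semicontinuous on $\mathrm{Gr}_{\{x\}}(\Phi)$, and suppose there exists $\lambda\in\mathbb{R}$ such that $u(x,y)<\lambda$ for some $y\in\Phi(x)$. If the function $u_{\lambda,x}$ is $\mathbb{K}\mathbb{N}$-inf-compact on $\mathrm{Gr}_{\{x\}}(\Phi_{\lambda,x})$, then $u^*$ is continuous at $x$, $\Phi^*(x)$ is nonempty and compact, and $\Phi^*$ is upper semicontinuous at $x$.
   Context: $X,Y$ are topological spaces, $\Phi:X\to 2^Y$ is a multifunction ($\Phi(x)\subset Y$, possibly empty), $\mathrm{Dom}(\Phi)=\{x\in X:\Phi(x)\ne\emptyset\}$, $\mathrm{Gr}_E(\Phi)=\{(x,y)\in E\times Y: y\in\Phi(x)\}$ for $E\subset X$, $\mathrm{Gr}(\Phi)=\mathrm{Gr}_X(\Phi)$. $u:\mathrm{Gr}(\Phi)\to\overline{\mathbb{R}}=\mathbb{R}\cup\{\pm\infty\}$. For $x\in\mathrm{Dom}(\Phi)$: $u^*(x)=\inf_{y\in\Phi(x)}u(x,y)$ (value function $u^*:\mathrm{Dom}(\Phi)\to\overline{\mathbb{R}}$) and $\Phi^*(x)=\{y\in\Phi(x):u(x,y)=u^*(x)\}$ (solutions multifunction). A neighborhood of $x$ is an open subset of $X$ containing $x$. A function $f:E\to\overline{\mathbb{R}}$ is lower semicontinuous (lsc) at $z\in E$ if $f(z)\le\liminf_\alpha f(z_\alpha)$ for every net $(z_\alpha)$ in $E$ with $z_\alpha\to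 z$; it is upper semicontinuous (usc) at $z$ if $-f$ is lsc at $z$; continuous if both. The multifunction $\Phi^*$ is upper semicontinuous at $x$ if for each open $V\subset Y$ with $\Phi^*(x)\subset V$ there is a neighborhood $U$ of $x$ with $\Phi^*(x')\subset V$ for all $x'\in U\cap\mathrm{Dom}(\Phi)$. Feasible path transfer upper semicontinuity: for $E\subset\mathrm{Dom}(\Phi)$, $u$ is feasible path transfer upper semicontinuous on $\mathrm{Gr}_E(\Phi)$ if for each $x\in E$, $y\in\Phi(x)$ and $\gamma\in\mathbb{R}$ with $u(x,y)<\gamma$ there is a neighborhood $U$ of $x$ such that for each $x'\in U$ there exists $y'\in\Phi(x')$ with $u(x',y')<\gamma$. $\mathbb{K}\mathbb{N}$-inf-compactness: for a multifunction $\Psi:X\to2^Y$, a function $v:\mathrm{Gr}(\Psi)\to\overline{\mathbb{R}}$ and $E\subset\mathrm{Dom}(\Psi)$, $v$ is $\mathbb{K}\mathbb{N}$-inf-compact on $\mathrm{Gr}_E(\Psi)$ if (i) $v$ is lsc (as a function on $\mathrm{Gr}(\Psi)$) at each $(x,y)\in\mathrm{Gr}_E(\Psi)$; and (ii) if a net $(x_\alpha)_{\alpha\in I}$ in $\mathrm{Dom}(\Psi)$ converges to $x\in E$, then each net $(y_\alpha)_{\alpha\in I}$ with $y_\alpha\in\Psi(x_\alpha)$ for all $\alpha$ such that $\{v(x_\alpha,y_\alpha)\}_{\alpha\in I}$ is bounded above has an accumulation point $y\in\Psi(x)$. Modified problem: given $x$ and $\lambda$ with $u(x,y)<\lambda$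 for some $y\in\Phi(x)$, define $\Phi_{\lambda,x}:X\to2^Y$ by $\Phi_{\lambda,x}(z)=\{y\in\Phi(z):u(z,y)\le\lambda\}$ if this set is nonempty, and $\Phi_{\lambda,x}(z)=\{y\in\Phi(x):u(x,y)\le\lambda\}$ otherwise; define $u_{\lambda,x}:\mathrm{Gr}(\Phi_{\lambda,x})\to\overline{\mathbb{R}}$ by $u_{\lambda,x}(z,y)=u(z,y)$ if $\{y\in\Phi(z):u(z,y)\le\lambda\}\neq\emptyset$, and $u_{\lambda,x}(z,y)=u(x,y)$ otherwise. *)

(* Defs.v *)
From HB Require Import structures.
From mathcomp Require Import all_boot all_order all_algebra.
From mathcomp Require Import all_classical all_reals all_analysis.
Set Implicit Arguments.
Unset Strict Implicit.
Unset Printing Implicit Defensive.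
Import Order.TTheory GRing.Theory Num.Theory.
Import numFieldNormedType.Exports.
Local Open Scope classical_set_scope.
Local Open Scope ring_scope.
Local Open Scope ereal_scope.

Definition directed (I : Type) (le : I -> I -> Prop) : Prop :=
  [/\ exists a : I, True,
      forall a, le a a,
      forall a b c, le a b -> le b c -> le a c &
      forall a b, exists c, le a c /\ le b c].

(* The filter on the index set generated by the tails [set b | le a b].  For a
   net s with index set (I, le), convergence to p is [s @ tails le --> p] and
   "p is an accumulation point of s" (s is frequently in every neighborhood of
   p) is [cluster (s @ tails le) p]. *)
Definition tails (I : Type) (le : I -> I -> Prop) : set_system I :=
  filter_from setT (fun a => [set b | le a b]).

Definition net_liminf (R : realType) (I : Type) (le : I -> I -> Prop)
    (f : I -> \bar R) : \bar R :=
  ereal_sup [set ereal_inf [set f b | b in [set b | le a b]] | a in setT].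

(* A function defined on a subset E of T is represented by a total function on
   T; only its values on E matter. *)
Definition lsc_at (R : realType) (T : topologicalType) (E : set T)
    (f : T -> \bar R) (z : T) : Prop :=
  forall (I : Type) (le : I -> I -> Prop) (s : I -> T),
    directed le -> (forall a, E (s a)) -> s @ tails le --> z ->
    f z <= net_liminf le (fun a => f (s a)).

Definition usc_at (R : realType) (T : topologicalType) (E : set T)
    (f : T -> \bar R) (z : T) : Prop :=
  lsc_at E (fun t => - f t) z.

Definition ereal_continuous_at (R : realType) (T : topologicalType)
    (E : set T) (f : T -> \bar R) (z : T) : Prop :=
  lsc_at E f z /\ usc_at E f z.

Section Multifunctions.
Context {R : realType} {X Y : topologicalType}.
Implicit Types (Phi Psi : X -> set Y) (u v : X * Y -> \bar R) (E : set X).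

Definition Dom Phi : set X := [set x | Phi x !=set0].

Definition Gr_on E Phi : set (X * Y) := [set p | E p.1 /\ Phi p.1 p.2].

Definition Gr Phi : set (X * Y) := Gr_on setT Phi.

(* Outside [Dom Phi] the value is +oo, the infimum of the empty set; it is
   never used. *)
Definition value Phi u (x : X) : \bar R := ereal_inf [set u (x, y) | y in Phi x].

Definition solutions Phi u (x : X) : set Y :=
  [set y | Phi x y /\ u (x, y) = value Phi u x].

(* Upper semicontinuity at x of Psi, regarded as a multifunction on D. *)
Definition multi_usc_at (D : set X) Psi (x : X) : Prop :=
  forall V : set Y, open V -> Psi x `<=` V ->
    exists U : set X, open_nbhs x U /\
      forall x', (U `&` D) x' -> Psi x' `<=` V.

Definition feasible_path_transfer_usc E Phi u : Prop :=
  forall x y (gamma : R), E x -> Phi x y -> u (x, y) < gamma%:E ->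
    exists U : set X, open_nbhs x U /\
      forall x', U x' -> exists y', Phi x' y' /\ u (x', y') < gamma%:E.

(* "Bounded above" means bounded above by a real number, although v may take
   the values +oo and -oo. *)
Definition KN_inf_compact E Psi v : Prop :=
  (forall p, Gr_on E Psi p -> lsc_at (Gr Psi) v p) /\
  (forall (I : Type) (le : I -> I -> Prop) (xs : I -> X) (x : X),
     directed le -> (forall a, Dom Psi (xs a)) -> E x ->
     xs @ tails le --> x ->
     forall ys : I -> Y, (forall a, Psi (xs a) (ys a)) ->
       (exists M : R, forall a, v (xs a, ys a) <= M%:E) ->
       exists y, Psi x y /\ cluster (ys @ tails le) y).

Definition sublevel Phi u (lambda : R) (z : X) : set Y :=
  [set y | Phi z y /\ u (z, y) <= lambda%:E].

Definition mod_multi Phi u (lambda : R) (x z : X) : set Y :=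
  if `[< sublevel Phi u lambda z !=set0 >] then sublevel Phi u lambda z
  else sublevel Phi u lambda x.

Definition mod_fun Phi u (lambda : R) (x : X) (p : X * Y) : \bar R :=
  if `[< sublevel Phi u lambda p.1 !=set0 >] then u p else u (x, p.2).

End Multifunctions.

(* Main.v *)
Require Import Defs.
From mathcomp Require Import all_boot all_order all_algebra.
From mathcomp Require Import all_classical all_reals all_analysis.
Local Open Scope classical_set_scope.
Local Open Scope ring_scope.
Local Open Scope ereal_scope.

Import Order.TTheory GRing.Theory Num.Theory.

(** Everything follows from one compactness property, [limit_selection], stated
    for filters rather than nets.  Let G be a filter of pairs (z, y) of the
    graph of Phi with u (z, y) <= lambda, whose first coordinates tend to x.
    At such a z the level set at lambda is nonempty, so the modified problem
    coincides with the original one along G; its objective is bounded there by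
    lambda, hence KN-inf-compactness yields an accumulation point y in Phi x of
    the second coordinates.  Since the first coordinates converge, (x, y) is an
    accumulation point of G, and lower semicontinuity shows that u (x, y) is at
    most every bound that u satisfies eventually along G.

    Each conclusion is then the choice of a filter G.
    - Existence of a minimizer: the level sets of u (x, .), placed over x.
    - Compactness of the solution set: an arbitrary filter on the solution set,
      placed over x.
    - Lower semicontinuity of the value: if values below c < value x occurred
      arbitrarily close to x, pairs with u <= c would accumulate at some (x, y)
      with u (x, y) <= c < value x.
    - Upper semicontinuity of the solutions: if solutions outside an open V
      containing those at x occurred arbitrarily close to x, they would
      accumulate at some y outside V, and y minimizes because the values at
      nearby points are eventually below any c > value x.

    The last point uses upper semicontinuity of the value, and this is where path
    transfer enters: a feasible y with u (x, y) < c can be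
    moved to all nearby points with the value staying below c. *)

(** * From filters to nets *)

Section NetOfFilter.
Context {T : Type} (G : set_system T) (E : set T).

(** The usual indexing of a net by pairs (member of the filter, point of it),
    with the members restricted to subsets of E so that every term of the net,
    and not only a tail of it, lies in E. *)
Definition net_index : Type :=
  {p : set T * T | [/\ G p.1, p.1 `<=` E & p.1 p.2]}.

Definition net_elt (A : set T) (a : T) (GA : G A) (AE : A `<=` E) (Aa : A a) :
  net_index := exist _ (A, a) (And3 GA AE Aa).

Definition net_le (p q : net_index) : Prop := (sval q).1 `<=` (sval p).1.

Definition net_point (p : net_index) : T := (sval p).2.

Lemma net_point_in (p : net_index) : E (net_point p).
Proof. by have [_ pE pt] := svalP p; apply: pE. Qed.

Context {G_proper : ProperFilter G} (GE : G E).

Lemma net_le_directed : directed net_le.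
Proof.
split.
- have [a Ea] := filter_ex GE.
  by exists (net_elt E a GE (@subset_refl _ E) Ea).
- by move=> p.
- by move=> p q r pq qr; apply: subset_trans qr pq.
- move=> [[A a] [/= GA AE Aa]] [[B b] [/= GB BE Bb]].
  have GAB : G (A `&` B) by apply: filterI.
  have [c ABc] := filter_ex GAB.
  have ABE : A `&` B `<=` E by move=> t [/AE].
  by exists (net_elt (A `&` B) c GAB ABE ABc); split=> t [].
Qed.

(** The tail of the net after the index (A, a) runs through exactly the points
    of the subsets of A that belong to G, that is, through A itself. *)
Lemma net_point_tails : net_point @ tails net_le = G.
Proof.
apply/seteqP; split => B.
- move=> [[[A a] [/= GA AE Aa]] _] sub; apply: (filterS _ GA) => t At.
  exact: sub (net_elt A t GA AE At) (@subset_refl _ A).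
- move=> GB; have GBE : G (B `&` E) by apply: filterI.
  have [c BEc] := filter_ex GBE.
  exists (net_elt (B `&` E) c GBE (@subIsetr _ B E) BEc) => //.
  by move=> [[A a] [/= GA AE Aa]] /(_ _ Aa) [].
Qed.

End NetOfFilter.

(** * Lower semicontinuity in terms of filters *)

Lemma real_between (R : realType) (a b : \bar R) :
  a < b -> exists r : R, a < r%:E /\ r%:E < b.
Proof.
case: a b => [a| |] [b| |] //= ab.
- exists ((a + b) / 2)%R; rewrite !lte_fin in ab *.
  by split; rewrite midf_lt.
- by exists (a + 1)%R; rewrite lte_fin ltrDl ltr01 ltry.
- by exists (b - 1)%R; rewrite ltNyr lte_fin gtrBl ltr01.
- by exists 0%R; rewrite ltNyr ltry.
Qed.

Section LowerSemicontinuity.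
Context {R : realType} {T : topologicalType}.
Variables (E : set T) (f : T -> \bar R) (z : T).

(** The weak inequality [c <= f t] is enough because [c] ranges over all levels
    below [f z], with room for a real number between the liminf and [f z].  It
    suits infima, for which only weak lower bounds pass from the terms. *)
Lemma lsc_at_near :
  (forall c, c < f z -> \forall t \near z, E t -> c <= f t) -> lsc_at E f z.
Proof.
move=> f_near I le s _ sE s_z; rewrite leNgt; apply/negP.
move=> /real_between[r [lim_r /f_near /s_z [a _ above]]].
move: lim_r; rewrite ltNge => /negP; apply.
apply: (@le_trans _ _ (ereal_inf [set f (s b) | b in [set b | le a b]])).
  by apply: le_ereal_inf_tmp => _ [b ab <-]; apply: above.
by apply: ereal_sup_ubound; exists a.
Qed.

(** The net of G is taken inside the set where E holds and f <= c, so that every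
    term, and with it the liminf, is at most c. *)
Lemma lsc_at_le (G : set_system T) (c : \bar R) :
  ProperFilter G -> G --> z -> lsc_at E f z ->
  G [set t | E t /\ f t <= c] -> f z <= c.
Proof.
move=> G_proper Gz f_lsc Gc.
set D := [set t | E t /\ f t <= c] in Gc.
have dir : directed (net_le G D) by apply: net_le_directed.
have pD p : D (net_point G D p) by apply: net_point_in.
have pz : net_point G D @ tails (net_le G D) --> z by rewrite net_point_tails.
have fz := f_lsc _ (net_le G D) (net_point G D) dir (fun p => (pD p).1) pz.
apply: le_trans fz _; apply: ge_ereal_sup => _ [p _ <-].
by apply: le_trans (pD p).2; apply: ereal_inf_lbound; exists p.
Qed.

End LowerSemicontinuity.

(** * Filters of pairs over a point *)

(** A property that fails at points z arbitrarily close to x is witnessed by a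
    filter of failing pairs over x; every argument by contradiction on a
    neighborhood of x goes through this filter. *)
Lemma near_of_filters {X Y : topologicalType} (x : X) (Q : set (X * Y)) :
  (forall G : set_system (X * Y), ProperFilter G -> fst @ G --> x -> ~ G Q) ->
  \forall z \near x, forall y, ~ Q (z, y).
Proof.
move=> noG; apply: contrapT => not_near.
pose B (U : set X) := [set p : X * Y | U p.1 /\ Q p].
apply: (noG (filter_from (nbhs x) B)).
- apply: filter_from_proper.
    apply: filter_from_filter; first by exists setT; apply: filterT.
    move=> U V Ux Vx; exists (U `&` V); first exact: filterI.
    by move=> p [[Up Vp] Qp].
  move=> U Ux; apply: contrapT => B0; apply: not_near.
  by apply: filterS Ux => z Uz y Qzy; apply: B0; exists (z, y).
- by move=> U Ux; exists U => // p [].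
- by exists setT; [exact: filterT | move=> p []].
Qed.

(** Convergence of the first coordinate upgrades accumulation of the second one:
    a member of G can be shrunk to the points whose first coordinate is close
    to x, and the image of what remains still meets every neighborhood of y. *)
Lemma cluster_pair {X Y : topologicalType} (G : set_system (X * Y)) x y :
  ProperFilter G -> fst @ G --> x -> cluster (snd @ G) y -> cluster G (x, y).
Proof.
move=> G_proper Gx Gy A B GA [[/= U V] [/= Ux Vy] UV].
have GAU : G (A `&` (fst @^-1` U)) by apply: filterI => //; apply: Gx.
have [|_ [[[a b] [Aab Ua] <-] Vb]] := Gy (snd @` (A `&` (fst @^-1` U))) V _ Vy.
  by apply: (@filterS _ G _ _ _ _ GAU) => p Ap; exists p.
by exists (a, b); split => //; apply: UV.
Qed.

(** * Parametric minimization *)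

Section ParametricMinimization.
Context {R : realType} {X Y : topologicalType}.
Variables (Phi : X -> set Y) (u : X * Y -> \bar R) (x : X) (lambda : R).

Lemma mod_multiE z :
  sublevel Phi u lambda z !=set0 ->
  mod_multi Phi u lambda x z = sublevel Phi u lambda z.
Proof. by move=> ne; rewrite /mod_multi; case: asboolP. Qed.

Lemma mod_funE z y :
  sublevel Phi u lambda z !=set0 ->
  mod_fun Phi u lambda x (z, y) = u (z, y).
Proof. by move=> ne; rewrite /mod_fun /=; case: asboolP. Qed.

Hypothesis feasible_lt : exists y, Phi x y /\ u (x, y) < lambda%:E.
Hypothesis mod_KN :
  KN_inf_compact [set x] (mod_multi Phi u lambda x) (mod_fun Phi u lambda x).

Lemma value_lt : value Phi u x < lambda%:E.
Proof.
have [y [Py uy]] := feasible_lt; apply: le_lt_trans uy.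
by apply: ereal_inf_lbound; exists y.
Qed.

(** The bound [u (x, y) <= c] is obtained along a filter H finer than G and
    converging to (x, y): lower semicontinuity of the modified objective
    applies there, and H inherits from G all eventual bounds.  The levels c are
    extended reals and y does not depend on c, so that c may tend to the value,
    even when the value is -oo. *)
Lemma limit_selection (G : set_system (X * Y)) :
  ProperFilter G -> fst @ G --> x ->
  G [set p | Phi p.1 p.2 /\ u p <= lambda%:E] ->
  exists y, [/\ Phi x y, cluster (snd @ G) y &
    forall c, G [set p | u p <= c] -> u (x, y) <= c].
Proof.
move=> G_proper Gx; set D := [set p | _ /\ _] => GD.
have [KN_lsc KN_cluster] := mod_KN.
(* A pair of D is itself a witness that the level set at its first coordinate
   is nonempty, which puts both definitions of the modified problem in their
   unmodified branch. *)
have ne z y : D (z, y) -> sublevel Phi u lambda z !=set0 by exists y.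
have xne : sublevel Phi u lambda x !=set0.
  by have [y [Py /ltW uy]] := feasible_lt; exists y.
have GrD : D `<=` Gr (mod_multi Phi u lambda x).
  by move=> [z y] Dzy; split => //=; rewrite mod_multiE //; apply: ne Dzy.
pose s := net_point G D.
have sG : s @ tails (net_le G D) = G by apply: net_point_tails.
have sD p : D (s p) by apply: net_point_in.
have F_s p : mod_multi Phi u lambda x (s p).1 (s p).2.
  by have [] := GrD _ (sD p).
have Dom_s p : Dom (mod_multi Phi u lambda x) (s p).1 by exists (s p).2.
have s_x : (fst \o s) @ tails (net_le G D) --> x.
  by move=> U Ux; have := Gx U Ux; rewrite -{1}sG.
have bounded p : mod_fun Phi u lambda x ((s p).1, (s p).2) <= lambda%:E.
  have := sD p; case: (s p) => z y Dzy.
  by rewrite mod_funE; [case: Dzy | apply: ne Dzy].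
have dir : directed (net_le G D) by apply: net_le_directed.
have [y [Fy cl]] := KN_cluster _ _ _ x dir Dom_s erefl s_x _ F_s
  (ex_intro _ lambda bounded).
have clG : cluster (snd @ G) y.
  by move=> A B GA; apply: cl; move: GA; rewrite -{1}sG.
move: (Fy); rewrite mod_multiE // => -[Py _].
exists y; split => // c Gc.
have := cluster_pair G x y G_proper Gx clG.
rewrite cluster_cvgE => -[H H_proper [Hxy GH]].
rewrite -mod_funE //; apply: (lsc_at_le _ _ _ H c) => //.
  by apply: KN_lsc.
apply: GH; apply: filterS (filterI GD Gc) => -[z y'] [Dzy uc].
by split; [exact: GrD | rewrite mod_funE //; apply: ne Dzy].
Qed.

Lemma solution_of_le y : Phi x y -> u (x, y) <= value Phi u x ->
  solutions Phi u x y.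
Proof.
move=> Py uy; split => //; apply/eqP; rewrite eq_le uy.
by apply: ereal_inf_lbound; exists y.
Qed.

(** The filter is generated by the level sets of u at the values u (x, y'), y'
    feasible at x.  Indexing by attained values rather than by levels above the
    infimum makes these sets nonempty for free, and the selected y then satisfies
    u (x, y) <= u (x, y') for every feasible y', which is minimality. *)
Lemma solutions_nonempty : solutions Phi u x !=set0.
Proof.
pose B y' := [set p : X * Y | [/\ p.1 = x, Phi x p.2 & u p <= u (x, y')]].
have [y0 [Py0 /ltW uy0]] := feasible_lt.
have B_proper : ProperFilter (filter_from (Phi x) B).
  apply: filter_from_proper.
    apply: filter_from_filter; first by exists y0.
    move=> y1 y2 P1 P2.
    by have [u12|/ltW u21] := leP (u (x, y1)) (u (x, y2));
      [exists y1 | exists y2] => // -[z y] [/= -> Py uy]; split; split => //=;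
      apply: le_trans uy _.
  by move=> y Py; exists (x, y).
have [||y [Py _ uy]] := limit_selection _ B_proper.
- move=> U Ux; exists y0 => // -[z y] [/= -> _ _].
  exact: nbhs_singleton Ux.
- by exists y0 => // -[z y] [/= -> Py uy]; split => //; apply: le_trans uy _.
exists y; apply: solution_of_le => //.
apply: le_ereal_inf_tmp => _ [y' Py' <-].
by apply: uy; exists y' => // p [].
Qed.

Lemma solutions_compact : compact (solutions Phi u x).
Proof.
move=> F F_proper FS.
have F_solutions (P : set Y) : solutions Phi u x `<=` P -> F P.
  by move=> SP; apply: filterS SP FS.
have [||y [Py cl uy]] := limit_selection ((fun y => (x, y)) @ F).
- by move=> U Ux; apply: F_solutions => y _; apply: (nbhs_singleton Ux).
- by apply: F_solutions => y [Py uy]; split => //=; rewrite uy ltW// value_lt.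
exists y; split => //; apply: solution_of_le => //; apply: uy.
by apply: F_solutions => y' [_ /= ->].
Qed.

(** The level set at c is empty over x; a filter of pairs of level at most c
    would select a point of it, so it is empty over all nearby points too. *)
Lemma value_near_ge c : c < value Phi u x ->
  \forall z \near x, c <= value Phi u z.
Proof.
move=> cv.
have : \forall z \near x, forall y, ~ (Phi z y /\ u (z, y) <= c).
  apply: (@near_of_filters X Y x [set p | Phi p.1 p.2 /\ u p <= c]).
  move=> G G_proper Gx Gc.
  have [|y [Py _ uy]] := limit_selection G G_proper Gx.
    apply: filterS Gc => p [Pp up]; split => //.
    exact: le_trans up (ltW (lt_trans cv value_lt)).
  have : u (x, y) <= c by apply: uy; apply: filterS Gc => p [].
  apply/negP; rewrite -ltNge; apply: lt_le_trans cv _.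
  by apply: ereal_inf_lbound; exists y.
apply: filterS => z above; apply: le_ereal_inf_tmp => _ [y Py <-].
by rewrite leNgt; apply/negP => /ltW uc; apply: (above y).
Qed.

Hypothesis transfer : feasible_path_transfer_usc [set x] Phi u.

Lemma value_near_lt (c : \bar R) : value Phi u x < c ->
  \forall z \near x, value Phi u z < c.
Proof.
move=> /real_between[r [/ereal_inf_lt[_ [y Py <-] uy] rc]].
have [U [Ux near_U]] := transfer x y r erefl Py uy.
apply: filterS (open_nbhs_nbhs Ux) => z /near_U [y' [Py' uy']].
apply: le_lt_trans (lt_trans uy' rc).
by apply: ereal_inf_lbound; exists y'.
Qed.

Lemma value_continuous D : ereal_continuous_at D (value Phi u) x.
Proof.
split; apply: lsc_at_near => c.
  by move=> /value_near_ge; apply: filterS.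
rewrite lteNr => /value_near_lt; apply: filterS => z /ltW vz _.
by rewrite leeNr.
Qed.

Lemma solutions_usc D : multi_usc_at D (solutions Phi u) x.
Proof.
move=> V V_open SV.
have : \forall z \near x, forall y, ~ (solutions Phi u z y /\ ~ V y).
  apply: (@near_of_filters X Y x [set p | solutions Phi u p.1 p.2 /\ ~ V p.2]).
  move=> G G_proper Gx GS.
  have Gc c : value Phi u x < c -> G [set p | u p <= c].
    (* At a pair of this filter u equals the value, which is eventually < c. *)
    move=> /value_near_lt near_c.
    have Gc : G [set p | value Phi u p.1 < c] := Gx _ near_c.
    by apply: filterS (filterI Gc GS) => -[z y] [/= /ltW vz [[_ /= ->] _]].
  have [|y [Py cl uy]] := limit_selection G G_proper Gx.
    apply: filterS (filterI (Gc _ value_lt) GS).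
    by move=> [z y] [/= uz [[]]].
  have /SV Vy : solutions Phi u x y.
    apply: solution_of_le => //; rewrite leNgt; apply/negP.
    move=> /real_between[r [/Gc/uy ur]].
    by rewrite ltNge ur.
  have GnV : (snd @ G) (~` V) by apply: (@filterS _ G _ _ _ _ GS) => p [].
  by have [y' []] := cl _ _ GnV (open_nbhs_nbhs (conj V_open Vy)).
rewrite /prop_near1 nbhsE => -[U Ux US]; exists U; split => // z [/US Uz _] y Sy.
by apply: contrapT => nVy; apply: (Uz y).
Qed.

End ParametricMinimization.

Theorem theorem9 (R : realType) (X Y : topologicalType) (Phi : X -> set Y)
    (u : X * Y -> \bar R) (x : X) (lambda : R) :
  Dom Phi x ->
  feasible_path_transfer_usc [set x] Phi u ->
  (exists y, Phi x y /\ u (x, y) < lambda%:E) ->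
  KN_inf_compact [set x] (mod_multi Phi u lambda x) (mod_fun Phi u lambda x) ->
  [/\ ereal_continuous_at (Dom Phi) (value Phi u) x,
      solutions Phi u x !=set0,
      compact (solutions Phi u x) &
      multi_usc_at (Dom Phi) (solutions Phi u) x].
Proof.
move=> _ transfer feasible_lt mod_KN; split.
- exact: value_continuous feasible_lt mod_KN transfer _.
- exact: solutions_nonempty feasible_lt mod_KN.
- exact: solutions_compact feasible_lt mod_KN.
- exact: solutions_usc feasible_lt mod_KN transfer _.
Qed.
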